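(* Let $n\ge2$, let $R$ be a commutative associative ring with unit, let $f^1,\ldots,f^n:R^+\times R^+\to\bigoplus_{1\le j<k\le n}R^+$ be symmetric 2-cocycles and let $G=N_{2,n}(R,f^1,\ldots,f^n)$. If a group $H$ is elementarily equivalent to $G$, then $H\cong N_{2,n}(S,q^1,\ldots,q^n)$ for some ring $S$ with $R\equiv S$ (as rings) and some symmetric 2-cocycles $q^1,\ldots,q^n:S^+\times S^+\to\bigoplus_{1\le j<k\le n}S^+$.
   Context: Two structures in the same language are elementarily equivalent ($\equiv$) if they satisfy the same first-order sentences. $R^+$ is the additive group of $R$. For abelian groups $A,B$, a 2-cocycle is a function $f:B\times B\to A$ with $f(0,x)=f(x,0)=0$ and $f(x+y,z)+f(x,y)=f(x,y+z)+f(y,z)$; it is symmetric if $f(x,y)=f(y,x)$ for all $x,y\in B$. For a ring $R$ with unit and symmetric 2-cocycles $f^1,\ldots,f^n:R^+\times R^+\to\bigoplus_{1\le j<k\le n}R^+$ with coordinates $f^i_{jk}$, $N_{2,n}(R,f^1,\ldots,f^n)$ is the set of all tuples $((\alpha_i)_{1\le i\le n},(\gamma_{ij})_{1\le i<j\le n})$ of elements of $R$ with the group multiplication $$((\alpha_i),(\gamma_{ij}))\odot((\beta_i),(\gamma'_{ij}))=\Big((\alpha_i+\beta_i),\big(\gamma_{ij}+\gamma'_{ij}+\alpha_i\beta_j+\sum_{k=1}^n f^k_{ij}(\alpha_k,\beta_k)\big)\Big).$$ *)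

(* Defs.v *)
From HB Require Import structures.
From mathcomp Require Import all_boot all_order all_algebra.

Set Implicit Arguments.
Unset Strict Implicit.
Unset Printing Implicit Defensive.

Import GRing.Theory.
Local Open Scope ring_scope.

Record signature := Signature {
  fsym : Type;
  farity : fsym -> nat;
  rsym : Type;
  rarity : rsym -> nat
}.

Record fo_structure (L : signature) := FOStructure {
  dom :> Type;
  finterp : forall c : fsym L, ('I_(farity c) -> dom) -> dom;
  rinterp : forall r : rsym L, ('I_(rarity r) -> dom) -> Prop
}.
Arguments FOStructure L dom finterp rinterp : clear implicits.

Inductive term (L : signature) :=
  | Var of nat
  | App (c : fsym L) of ('I_(farity c) -> term L).

(* Variables are named by natural numbers; equality is a logical symbol. *)
Inductive formula (L : signature) :=
  | Eq of term L & term L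
  | Rel (r : rsym L) of ('I_(rarity r) -> term L)
  | Bot
  | And of formula L & formula L
  | Or of formula L & formula L
  | Imp of formula L & formula L
  | All of nat & formula L
  | Ex of nat & formula L.

Arguments Var {L}.
Arguments App {L}.
Arguments Eq {L}.
Arguments Rel {L}.
Arguments Bot {L}.
Arguments And {L}.
Arguments Or {L}.
Arguments Imp {L}.
Arguments All {L}.
Arguments Ex {L}.

Section Semantics.
Variables (L : signature) (M : fo_structure L).

Fixpoint eval (e : nat -> M) (t : term L) : M :=
  match t with
  | Var x => e x
  | App c a => finterp (fun i => eval e (a i))
  end.

Fixpoint holds (e : nat -> M) (phi : formula L) : Prop :=
  match phi with
  | Eq t u => eval e t = eval e u
  | Rel r a => rinterp (fun i => eval e (a i))
  | Bot => False
  | And p q => holds e p /\ holds e q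
  | Or p q => holds e p \/ holds e q
  | Imp p q => holds e p -> holds e q
  | All x p => forall a : M, holds [eta e with x |-> a] p
  | Ex x p => exists a : M, holds [eta e with x |-> a] p
  end.

(* For a sentence and a nonempty [M], the value does not depend on [e]. *)
Definition models (phi : formula L) : Prop := forall e : nat -> M, holds e phi.

End Semantics.

Fixpoint occurs (L : signature) (x : nat) (t : term L) : Prop :=
  match t with
  | Var y => x = y
  | App c a => exists i, occurs x (a i)
  end.

Fixpoint free_in (L : signature) (x : nat) (phi : formula L) : Prop :=
  match phi with
  | Eq t u => occurs x t \/ occurs x u
  | Rel r a => exists i, occurs x (a i)
  | Bot => False
  | And p q | Or p q | Imp p q => free_in x p \/ free_in x q
  | All y p | Ex y p => x <> y /\ free_in x p
  end.

Definition sentence (L : signature) (phi : formula L) : Prop :=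
  forall x, ~ free_in x phi.

Definition elem_equiv (L : signature) (M N : fo_structure L) : Prop :=
  forall phi : formula L, sentence phi -> (models M phi <-> models N phi).

Inductive group_fsym := gOne | gMul | gInv.

Definition group_farity (c : group_fsym) : nat :=
  match c with gOne => 0 | gMul => 2 | gInv => 1 end.

Definition group_sig : signature :=
  Signature group_farity (fun r : void => match r with end).

Definition group_finterp (G : groupType) (c : group_fsym) :
    ('I_(group_farity c) -> G) -> G :=
  match c with
  | gOne => fun=> 1%g
  | gMul => fun a => (a ord0 * a ord_max)%g
  | gInv => fun a => (a ord0)^-1%g
  end.

Definition group_structure (G : groupType) : fo_structure group_sig :=
  FOStructure group_sig G (@group_finterp G) (fun r : void => match r with end).

Inductive ring_fsym := rZero | rOne | rAdd | rOpp | rMul.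

Definition ring_farity (c : ring_fsym) : nat :=
  match c with rZero | rOne => 0 | rAdd | rMul => 2 | rOpp => 1 end.

Definition ring_sig : signature :=
  Signature ring_farity (fun r : void => match r with end).

Definition ring_finterp (R : pzRingType) (c : ring_fsym) :
    ('I_(ring_farity c) -> R) -> R :=
  match c with
  | rZero => fun=> 0
  | rOne => fun=> 1
  | rAdd => fun a => a ord0 + a ord_max
  | rOpp => fun a => - a ord0
  | rMul => fun a => a ord0 * a ord_max
  end.

Definition ring_structure (R : pzRingType) : fo_structure ring_sig :=
  FOStructure ring_sig R (@ring_finterp R) (fun r : void => match r with end).

Definition group_isomorphic (G H : groupType) : Prop :=
  exists phi : {multiplicative G -> H}, bijective phi.

Record sym_cocycle (B A : zmodType) := SymCocycle {
  cocycle_fun :> B -> B -> A;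
  cocycle0x : forall x, cocycle_fun 0 x = 0;
  cocyclex0 : forall x, cocycle_fun x 0 = 0;
  cocycleP : forall x y z,
    cocycle_fun (x + y) z + cocycle_fun x y =
    cocycle_fun x (y + z) + cocycle_fun y z;
  cocycleC : forall x y, cocycle_fun x y = cocycle_fun y x
}.

(* Indices (i, j) with i < j.  The direct sum of copies of R^+ over this
   finite set is the additive group [{ffun lt_idx n -> R}]. *)
Definition lt_idx (n : nat) := {p : 'I_n * 'I_n | (p.1 < p.2)%N}.

(* The group N_{2,n}(R, f^1, ..., f^n): tuples (alpha, gamma) under [N2_mul]. *)
Definition N2 (n : nat) (R : pzRingType)
    (f : 'I_n -> sym_cocycle R {ffun lt_idx n -> R}) : Type :=
  ({ffun 'I_n -> R} * {ffun lt_idx n -> R})%type.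

Section N2Group.
Variables (n : nat) (R : pzRingType).
Variable f : 'I_n -> sym_cocycle R {ffun lt_idx n -> R}.

HB.instance Definition _ := Choice.on (N2 f).

Definition N2_one : N2 f := (0, 0).

Definition N2_mul (x y : N2 f) : N2 f :=
  ([ffun i => x.1 i + y.1 i],
   [ffun p => x.2 p + y.2 p + x.1 (val p).1 * y.1 (val p).2
              + \sum_(k < n) f k (x.1 k) (y.1 k) p]).

Definition N2_inv (x : N2 f) : N2 f :=
  ([ffun i => - x.1 i],
   [ffun p => - x.2 p + x.1 (val p).1 * x.1 (val p).2
              - \sum_(k < n) f k (x.1 k) (- x.1 k) p]).

Lemma N2_mulA : associative N2_mul.
Proof.
move=> x y z; congr pair; apply/ffunP => i; rewrite !ffunE ?addrA //=.
set i1 := (val i).1; set i2 := (val i).2.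
have cE : \sum_(k < n) f k (x.1 k + y.1 k) (z.1 k) i
          + \sum_(k < n) f k (x.1 k) (y.1 k) i
        = \sum_(k < n) f k (x.1 k) (y.1 k + z.1 k) i
          + \sum_(k < n) f k (y.1 k) (z.1 k) i.
  rewrite -!big_split /=; apply: eq_bigr => k _.
  by have /ffunP/(_ i) := cocycleP (f k) (x.1 k) (y.1 k) (z.1 k); rewrite !ffunE.
under [X in _ + X = _]eq_bigr do rewrite ffunE.
under [X in _ = _ + X]eq_bigr do rewrite ffunE.
rewrite mulrDl mulrDr !addrA.
rewrite [LHS](ACl (1*2*3*4*6*7*(8*5)))%AC /= -cE.
by rewrite [RHS](ACl (1*2*5*7*3*6*(8*4)))%AC /=.
Qed.

Lemma N2_mul1 : left_id N2_one N2_mul.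
Proof.
case=> a c; congr pair; apply/ffunP => i; rewrite !ffunE ?add0r //= mul0r addr0.
by rewrite big1 ?addr0 // => k _; rewrite !ffunE cocycle0x ffunE.
Qed.

Lemma N2_1mul : right_id N2_one N2_mul.
Proof.
case=> a c; congr pair; apply/ffunP => i; rewrite !ffunE ?addr0 //= mulr0 addr0.
by rewrite big1 ?addr0 // => k _; rewrite !ffunE cocyclex0 ffunE.
Qed.

Lemma N2_mulV : right_inverse N2_one N2_inv N2_mul.
Proof.
move=> x; congr pair; apply/ffunP => i; rewrite !ffunE ?subrr //= mulrN.
under [X in _ - _ + X]eq_bigr do rewrite ffunE.
by rewrite !addrA [LHS](ACl ((1*2)*(3*5)*(4*6)))%AC /= !subrr addNr !addr0.
Qed.

Lemma N2_Vmul : left_inverse N2_one N2_inv N2_mul.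
Proof.
move=> x; congr pair; apply/ffunP => i; rewrite !ffunE ?addNr //= mulNr.
under [X in _ - _ + X]eq_bigr do rewrite ffunE cocycleC.
by rewrite [LHS](ACl ((1*4)*(2*5)*(3*6)))%AC /= addNr subrr addNr !addr0.
Qed.

HB.instance Definition _ :=
  isGroup.Build (N2 f) N2_mulA N2_mul1 N2_1mul N2_Vmul N2_mulV.

End N2Group.

(* Main.v *)
Require Import Defs.
From HB Require Import structures.
From mathcomp Require Import all_boot all_order all_algebra.
From mathcomp Require Import boolp ring.

(** The centre Z of G = N_{2,n}(R, f) consists of the tuples with zero first
    component, and the commutator of two tuples depends on their first
    components only: its coordinate at i < j is the minor a_i b_j - b_i a_j.
    The cocycles are therefore invisible to the commutator map
    G/Z x G/Z -> Z, which is the exterior square of the free module R^n.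
    Everything is read off from this alternating map.

    Interpretation of R with parameters.  Let x_i be the tuple whose first
    component is the i-th unit vector.  A scalar s is encoded by the central
    element s[x_0, x_1], and the relation v = s u modulo Z is definable from
    x_0 and x_1: if w_0 = s x_0 and w_1 = s x_1, then [w_0, u] = [x_0, v]
    fixes all coordinates of v except the one at x_0, and [w_1, u] = [x_1, v]
    fixes all except the one at x_1.  This is the relation [act].  The record
    [good] says, in finitely many first-order properties, that [act] behaves
    as the multiplication by a commutative ring, that the x_i form a basis
    of G modulo its centre, and that the [x_i, x_j] form a basis of the
    centre.  The standard tuple of G is good ([good_std]), so an elementarily
    equivalent group H has a good tuple as well.

    From a good tuple to an isomorphism.  The ring S is the set of scalars of
    the good tuple of H ([scal]).  Choose a representative of s x_i for each
    s in S and each i.  Representatives fail to be additive by central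
    elements; these defects are symmetric 2-cocycles because all multiples of
    one x_i commute, and reading them in the basis [x_i, x_j] of the centre
    gives the cocycles q^i.  Multiplying representatives in decreasing order
    of i yields the isomorphism ([group_isomorphic_N2]): moving the factor for
    j to the left past the factor for i < j produces exactly the term
    a_i b_j of the multiplication law.

    Elementary equivalence of the rings.  About the tuple found in H it is
    only known that it is good, so it matters that every good tuple of G, not
    only the standard one, has a ring of scalars isomorphic to R.  This holds
    because R is the whole ring of scalars of the exterior square: an
    operation phi on G/Z with [phi u, v] = [u, phi v] and [u, phi u] = 1 is
    the multiplication by an element of R ([act_is_multiple]).  Hence, for a
    ring sentence phi true in R, every good tuple of G satisfies the group
    formula that says phi in its ring of scalars, and so does every good
    tuple of H. *)

Set Implicit Arguments.
Unset Strict Implicit.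
Unset Printing Implicit Defensive.

Import GRing.Theory.

(** * Predicates expressed by formulas of group theory *)

(** Formulas name variables by natural numbers.  Numbering the variables by
    this countable type instead gives single variables [inl k] and, for each
    slot c, an infinite family [inr (c, i)]; distinctness of two variables then
    holds by computation even when i is a parameter. *)
Notation var := (nat + nat * nat)%type.

Definition upd T (e : var -> T) (v : var) (a : T) : var -> T :=
  fun w => if w == v then a else e w.

(** One formula has to serve for all groups at once, since it is used to
    transfer a property from one group to another. *)
Definition definable (P : forall G : groupType, (var -> G) -> Prop) :=
  exists phi : formula group_sig, forall (G : groupType) (e : nat -> G),
    holds (M := group_structure G) e phi <-> P G (e \o pickle).

Definition definable_term (t : forall G : groupType, (var -> G) -> G) :=
  exists u : term group_sig, forall (G : groupType) (e : nat -> G),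
    eval (M := group_structure G) e u = t G (e \o pickle).

Lemma upd_pickle T (e : nat -> T) (v : var) (a : T) :
  [eta e with pickle v |-> a] \o pickle = upd (e \o pickle) v a.
Proof.
by apply/funext => w; rewrite /upd /= (inj_eq (pcan_inj pickleK)).
Qed.

Lemma definable_iff (P Q : forall G : groupType, (var -> G) -> Prop) :
  (forall G e, P G e <-> Q G e) -> definable Q -> definable P.
Proof.
move=> PQ [phi phiP]; exists phi => G e; split.
  by move/phiP/PQ.
by move/PQ/phiP.
Qed.

Lemma definable_var v : definable_term (fun G e => e v).
Proof. by exists (Var (pickle v)). Qed.

Lemma definable_one : definable_term (fun G e => 1%g).
Proof. by exists (@App group_sig gOne (fun _ => Var 0)). Qed.

Lemma definable_inv t :
  definable_term t -> definable_term (fun G e => (t G e)^-1)%g.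
Proof.
move=> [u uP]; exists (@App group_sig gInv (fun _ => u)) => G e /=.
by rewrite uP.
Qed.

Lemma definable_mul t t' : definable_term t -> definable_term t' ->
  definable_term (fun G e => t G e * t' G e)%g.
Proof.
move=> [u uP] [u' u'P].
exists (@App group_sig gMul (fun i => if i == ord0 then u else u')) => G e /=.
by rewrite uP u'P.
Qed.

Lemma definable_comm t t' : definable_term t -> definable_term t' ->
  definable_term (fun G e => [~ t G e, t' G e])%g.
Proof.
move=> td t'd; have tt' := definable_mul td t'd.
by have := definable_mul (definable_inv td) (definable_mul (definable_inv t'd) tt').
Qed.

Lemma definable_prod (I : Type) (r : seq I) (p : pred I)
    (t : I -> forall G : groupType, (var -> G) -> G) :
  (forall i, definable_term (t i)) ->
  definable_term (fun G e => \prod_(i <- r | p i) t i G e)%g.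
Proof.
move=> tP; elim: r => [|i r [u uP]].
  by have [u uP] := definable_one; exists u => G e; rewrite uP big_nil.
have [w wP] := tP i; have [pi|npi] := boolP (p i).
  have [] := @definable_mul (t i) (fun G e => \prod_(i <- r | p i) t i G e)%g.
  - by exists w.
  - by exists u.
  by move=> y yP; exists y => G e; rewrite yP big_cons pi.
by exists u => G e; rewrite uP big_cons (negPf npi).
Qed.

Lemma definable_eq t t' : definable_term t -> definable_term t' ->
  definable (fun G e => t G e = t' G e).
Proof.
by move=> [u uP] [u' u'P]; exists (Eq u u') => G e /=; rewrite uP u'P.
Qed.

Lemma definable_false : definable (fun G e => False).
Proof. by exists Bot. Qed.

Lemma definable_true : definable (fun G e => True).
Proof. by exists (Eq (Var 0) (Var 0)). Qed.

Lemma definable_imp P Q : definable P -> definable Q ->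
  definable (fun G e => P G e -> Q G e).
Proof.
by move=> [p pP] [q qP]; exists (Imp p q) => G e /=; rewrite pP qP.
Qed.

Lemma definable_and P Q : definable P -> definable Q ->
  definable (fun G e => P G e /\ Q G e).
Proof.
by move=> [p pP] [q qP]; exists (And p q) => G e /=; rewrite pP qP.
Qed.

Lemma definable_or P Q : definable P -> definable Q ->
  definable (fun G e => P G e \/ Q G e).
Proof.
by move=> [p pP] [q qP]; exists (Or p q) => G e /=; rewrite pP qP.
Qed.

Lemma definable_updE v P : definable P ->
  definable (fun G e => exists a, P G (upd e v a)).
Proof.
move=> [p pP]; exists (Ex (pickle v) p) => G e /=.
by split=> -[a H]; exists a; move: H; rewrite pP upd_pickle.
Qed.

Lemma definable_updA v P : definable P ->
  definable (fun G e => forall a, P G (upd e v a)).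
Proof.
move=> [p pP]; exists (All (pickle v) p) => G e /=.
by split=> H a; move: (H a); rewrite pP upd_pickle.
Qed.

(** The first hypothesis says that [v] is a fresh name for the bound variable;
    for a concrete [Q] it holds by computation. *)
Lemma definable_ex v (Q : forall G : groupType, (var -> G) -> G -> Prop) :
  (forall G e b a, Q G (upd e v b) a <-> Q G e a) ->
  definable (fun G e => Q G e (e v)) ->
  definable (fun G e => exists a, Q G e a).
Proof.
move=> Qv /(definable_updE v); apply: definable_iff => G e.
by split=> -[a]; rewrite ?Qv /upd eqxx => ?; exists a; rewrite ?Qv ?eqxx.
Qed.

Lemma definable_all v (Q : forall G : groupType, (var -> G) -> G -> Prop) :
  (forall G e b a, Q G (upd e v b) a <-> Q G e a) ->
  definable (fun G e => Q G e (e v)) ->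
  definable (fun G e => forall a, Q G e a).
Proof.
move=> Qv /(definable_updA v); apply: definable_iff => G e.
by split=> H a; move: (H a); rewrite ?Qv /upd ?eqxx.
Qed.

Lemma definable_allI (I : finType)
    (P : I -> forall G : groupType, (var -> G) -> Prop) :
  (forall i, definable (P i)) -> definable (fun G e => forall i, P i G e).
Proof.
move=> Pdef.
suff /(_ (enum I)) : forall s : seq I,
    definable (fun G e => forall i, i \in s -> P i G e).
  apply: definable_iff => G e; split=> H i; first by move=> _; apply: H.
  by apply: H; rewrite mem_enum.
elim=> [|i s IH].
  by apply: definable_iff definable_true => G e; split.
apply: definable_iff (definable_and (Pdef i) IH) => G e; split=> [H|[Hi H] j].
  by split=> [|j js]; apply: H; rewrite inE ?eqxx ?js ?orbT.
by rewrite inE => /predU1P[->|/H].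
Qed.

(** All variables of a slot are changed at once, so that freshness of a slot
    can be stated without a bound on the length of the families stored in it. *)
Definition updF T (e : var -> T) (c : nat) (b : nat -> T) : var -> T :=
  fun w => if w is inr (c', k) then if c' == c then b k else e w else e w.

(** A quantifier over functions on a finite type is a finite string of
    quantifiers over elements. *)
Lemma definable_exF (I : finType) c
    (Q : forall G : groupType, (var -> G) -> (I -> G) -> Prop) :
  (forall G e b a, Q G (updF e c b) a <-> Q G e a) ->
  definable (fun G e => Q G e (fun i => e (inr (c, pickle i)))) ->
  definable (fun G e => exists a, Q G e a).
Proof.
move=> Qc; set P := (X in definable X) => Pdef.
pose updl (G : groupType) (e : var -> G) (l : seq nat) b : var -> G :=
  fun w => if w is inr (c', k) then
             if (c' == c) && (k \in l) then b k else e w else e w.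
have : definable (fun G e => exists b, P G (updl G e (map pickle (enum I)) b)).
  (* One existential quantifier for each index of the slot, by induction on
     the list of indices. *)
  elim: (map _ _) => [|k l /(definable_updE (inr (c, k)))].
    apply: definable_iff Pdef => G e.
    have E b : updl G e [::] b = e.
      by apply/funext => -[//|[c' k]]; rewrite /updl andbF.
    by split=> [[b]|]; rewrite ?E // => ?; exists (fun=> 1%g); rewrite E.
  apply: definable_iff => G e; split=> [[b]|[a [b]]].
    rewrite (_ : updl _ _ _ _ = updl G (upd e (inr (c, k)) (b k)) l b).
      by move=> ?; exists (b k), b.
    apply/funext => -[//|[c' k']] /=; rewrite inE /upd.
    rewrite -[inr _ == _]/((c' == c) && (k' == k)).
    by case: eqP => //= _; case: (eqVneq k' k) => //= ->; case: ifP.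
  exists (fun j => if j \in l then b j else a).
  rewrite (_ : updl _ _ _ _ = updl G (upd e (inr (c, k)) a) l b) //.
  apply/funext => -[//|[c' k']] /=; rewrite inE /upd.
  rewrite -[inr _ == _]/((c' == c) && (k' == k)).
  by case: eqP => //= _; case: (k' == k); case: (k' \in l).
apply: definable_iff => G e; split=> [[a Qa]|[b]].
  pose b k := if unpickle k is Some i then a i else 1%g; exists b.
  rewrite /P (_ : updl _ _ _ _ = updF e c
      (fun k => if k \in map pickle (enum I) then b k else e (inr (c, k)))).
    rewrite Qc /= eqxx (_ : (fun i => _) = a) //; apply/funext => i.
    by rewrite map_f ?mem_enum // /b pickleK.
  apply/funext => -[//|[c' k']] /=.
  by case: eqP => //= ->.
rewrite /P (_ : updl _ _ _ _ = updF e c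
      (fun k => if k \in map pickle (enum I) then b k else e (inr (c, k)))).
  by rewrite Qc => ?; eexists; eassumption.
apply/funext => -[//|[c' k']] /=.
by case: eqP => //= ->.
Qed.

Lemma definable_allF (I : finType) c
    (Q : forall G : groupType, (var -> G) -> (I -> G) -> Prop) :
  (forall G e b a, Q G (updF e c b) a <-> Q G e a) ->
  definable (fun G e => Q G e (fun i => e (inr (c, pickle i)))) ->
  definable (fun G e => forall a, Q G e a).
Proof.
move=> Qc Qdef.
have : definable (fun G e => (exists a, (Q G e a -> False)) -> False).
  apply: definable_imp definable_false.
  apply: (definable_exF (c := c)) (definable_imp Qdef definable_false).
  by move=> G e b a; rewrite Qc.
apply: definable_iff => G e; split=> [H [a]|H a]; first exact.
by apply: contrapT => nQ; apply: H; exists a.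
Qed.

(** * Sentences, isomorphisms and transfer *)

Section FirstOrder.
Variable L : signature.

Lemma eval_ext (M : fo_structure L) (e e' : nat -> M) (t : term L) :
  (forall v, occurs v t -> e v = e' v) -> eval e t = eval e' t.
Proof.
elim: t => [v|c a IH] /= H; first exact: H.
by congr finterp; apply/funext => i; apply: IH => v ?; apply: H; exists i.
Qed.

Lemma holds_ext (M : fo_structure L) (e e' : nat -> M) (phi : formula L) :
  (forall v, free_in v phi -> e v = e' v) -> holds e phi <-> holds e' phi.
Proof.
have bind v (p : formula L) (f f' : nat -> M) (a : M) :
    (forall w, w <> v /\ free_in w p -> f w = f' w) ->
    forall w, free_in w p -> [eta f with v |-> a] w = [eta f' with v |-> a] w.
  by move=> ff' w wp /=; case: eqP => // wv; apply: ff'.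
elim: phi e e' => [t u|r a||p IHp q IHq|p IHp q IHq|p IHp q IHq|v p IH|v p IH]
  e e' /= ee'.
- by rewrite (@eval_ext _ e e' t) ?(@eval_ext _ e e' u) // => v ?; apply: ee'; auto.
- rewrite (_ : (fun i => eval e (a i)) = (fun i => eval e' (a i))) //.
  by apply/funext => i; apply: eval_ext => v ?; apply: ee'; exists i.
- by [].
- by rewrite (IHp e e') ?(IHq e e') // => v ?; apply: ee'; auto.
- by rewrite (IHp e e') ?(IHq e e') // => v ?; apply: ee'; auto.
- by rewrite (IHp e e') ?(IHq e e') // => v ?; apply: ee'; auto.
- by split=> H a; move: (H a); apply IH; apply: bind => w /ee'.
- by split=> -[a H]; exists a; move: H; apply IH; apply: bind => w /ee'.
Qed.

Lemma free_in_bound (phi : formula L) :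
  exists N, forall v, free_in v phi -> (v < N)%N.
Proof.
have tuple_bound k (P : 'I_k -> nat -> Prop) :
    (forall i, exists N, forall v, P i v -> (v < N)%N) ->
    exists N, forall v, (exists i, P i v) -> (v < N)%N.
  move=> /choice[N NP]; exists (\max_i N i) => v [i /NP vN].
  exact: leq_trans vN (leq_bigmax i).
have pair_bound (P Q : nat -> Prop) :
    (exists N, forall v, P v -> (v < N)%N) ->
    (exists N, forall v, Q v -> (v < N)%N) ->
    exists N, forall v, P v \/ Q v -> (v < N)%N.
  move=> [N NP] [N' NP']; exists (maxn N N') => v; rewrite leq_max.
  by case=> [/NP|/NP'] ->; rewrite ?orbT.
have term_bound (t : term L) : exists N, forall v, occurs v t -> (v < N)%N.
  elim: t => [w|c a IH] /=; first by exists w.+1 => v ->.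
  exact: tuple_bound.
elim: phi => [t u|r a||p IHp q IHq|p IHp q IHq|p IHp q IHq|v p IH|v p IH] /=;
  do ?[exact: pair_bound | exact: tuple_bound].
- by exists 0%N.
- by case: IH => N NP; exists N => w [_ /NP].
- by case: IH => N NP; exists N => w [_ /NP].
Qed.

Lemma models_All (M : fo_structure L) v (p : formula L) :
  models M (All v p) <-> models M p.
Proof.
split=> H e /=; last by move=> a; apply: H.
have := H e (e v); apply holds_ext => w _ /=.
by case: eqP => // ->.
Qed.

(** Universal closure turns equality of theories into agreement on every
    formula that holds under all assignments. *)
Lemma elem_equiv_models (M N : fo_structure L) (phi : formula L) :
  elem_equiv M N -> models M phi <-> models N phi.
Proof.
move=> MN; have [k kP] := free_in_bound phi.
pose closure := foldr All phi (iota 0 k).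
have closureE (K : fo_structure L) : models K closure <-> models K phi.
  by rewrite /closure; elim: (iota 0 k) => //= v s <-; apply: models_All.
rewrite -!closureE; apply: MN => v.
have : forall s, free_in v (foldr All phi s) -> v \notin s /\ free_in v phi.
  elim=> [|w s IH] //= [vw /IH[vs vphi]]; split=> //.
  by rewrite inE negb_or vs andbT; apply/eqP.
move=> /[apply] -[+ /kP]; rewrite mem_iota add0n => /negP.
by [].
Qed.

Lemma holds_iso (M N : fo_structure L) (h : M -> N) :
  (forall b, exists a, h a = b) -> injective h ->
  (forall c a, h (finterp (c := c) a) = finterp (fun i => h (a i))) ->
  (forall r a, rinterp (r := r) a <-> rinterp (fun i => h (a i))) ->
  forall (phi : formula L) (e : nat -> M), holds e phi <-> holds (h \o e) phi.
Proof.
move=> hsurj hinj hfun hrel.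
have hterm (t : term L) e : h (eval e t) = eval (h \o e) t.
  elim: t => //= c a IH; rewrite hfun; congr finterp; exact/funext.
have hupd e v a : h \o [eta e with v |-> a] = [eta h \o e with v |-> h a].
  by apply/funext => w /=; case: eqP.
elim=> [t u|r a||p IHp q IHq|p IHp q IHq|p IHp q IHq|v p IH|v p IH] e /=.
- by rewrite -!hterm; split=> [->|/hinj].
- rewrite hrel (_ : (fun i => h _) = (fun i => eval (h \o e) (a i))) //.
  exact/funext.
- by [].
- by rewrite IHp IHq.
- by rewrite IHp IHq.
- by rewrite IHp IHq.
- split=> H a; last by apply/IH; rewrite hupd; apply: H.
  by have [b <-] := hsurj a; rewrite -hupd; apply/IH.
- split=> -[a H].
    by exists (h a); rewrite -hupd; apply/IH.
  by have [b ba] := hsurj a; exists b; apply/IH; rewrite hupd ba.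
Qed.

End FirstOrder.

(** The form in which elementary equivalence of groups is used: no formula has
    to be written down. *)
Lemma definable_transfer (G H : groupType)
    (P : forall K : groupType, (var -> K) -> Prop) :
  elem_equiv (group_structure H) (group_structure G) -> definable P ->
  (forall e : var -> G, P G e) <-> (forall e : var -> H, P H e).
Proof.
move=> HG [phi phiP].
have E (K : groupType) : (forall e : var -> K, P K e) <->
    models (group_structure K) phi.
  split=> [PK e|HK e]; first by apply/phiP.
  have -> : e = (fun k => if pickle_inv k is Some v then e v else 1%g) \o pickle.
    by apply/funext => v /=; rewrite pickleK_inv.
  exact/phiP/HK.
by rewrite !E (elem_equiv_models phi HG).
Qed.

(** * The scalar action defined by a tuple of parameters *)

Ltac definable_term_tac :=
  repeat first
    [ apply: definable_var | apply: definable_one | apply: definable_prod; intro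
    | apply: definable_comm | apply: definable_inv | apply: definable_mul ].

(** The argument is the first fresh number: single variables are named
    [inl k], families are stored in slot [k + 1], and slot 0 is left to the
    parameters. *)
Ltac definable_tac k :=
  lazymatch goal with
  | |- definable (fun G e => @?P G e /\ @?Q G e) =>
      apply: (@definable_and P Q); definable_tac k
  | |- definable (fun G e => @?P G e \/ @?Q G e) =>
      apply: (@definable_or P Q); definable_tac k
  | |- definable (fun G e => @?P G e -> @?Q G e) =>
      apply: (@definable_imp P Q); definable_tac k
  | |- definable (fun G e => forall a : Group.sort G, @?Q G e a) =>
      apply: (@definable_all (inl k) Q); [by [] | definable_tac (S k)]
  | |- definable (fun G e => exists a : Group.sort G, @?Q G e a) =>
      apply: (@definable_ex (inl k) Q); [by [] | definable_tac (S k)]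
  | |- definable (fun G e => forall a : _ -> Group.sort G, @?Q G e a) =>
      apply: (@definable_allF _ (S k) Q); [by [] | definable_tac (S k)]
  | |- definable (fun G e => exists a : _ -> Group.sort G, @?Q G e a) =>
      apply: (@definable_exF _ (S k) Q); [by [] | definable_tac (S k)]
  | |- definable (fun G e => forall i : ?I, @?P G e i) =>
      refine (@definable_allI _ (fun i G e => P G e i) _); intro; definable_tac k
  | |- definable (fun G e => False) => exact: definable_false
  | |- definable (fun G e => _ = _) =>
      apply: definable_eq; definable_term_tac
  | _ => idtac
  end.

Definition central (G : groupType) (z : G) := forall y : G, (z * y = y * z)%g.

Section Good.
Variables (n : nat) (i0 i1 : 'I_n).
Local Open Scope group_scope.

(** Think of [w0] and [w1] as s x_0 and s x_1.  Both are needed: the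
    commutator with x_0 loses the x_0-coordinate of [v], the commutator with
    x_1 recovers it.  The scalar itself is represented by the element
    [s = [~ w0, x i1]] of the centre, so that equality of scalars is equality
    in the group; [act x s 1 1] says that [s] represents a scalar. *)
Definition act (G : groupType) (x : 'I_n -> G) (s u v : G) :=
  exists w0 w1 : G, [~ w0, x i0] = 1 /\ [~ w1, x i1] = 1 /\
    [~ w0, x i1] = s /\ [~ x i0, w1] = s /\
    [~ w0, u] = [~ x i0, v] /\ [~ w1, u] = [~ x i1, v].

(** Each field holds for the standard tuple because there [act x s u v] means
    that [v] is a multiple of [u] modulo the centre.  The fields up to
    [good_act_val] make the set of scalars a commutative ring acting modulo
    the centre; [good_act_comm] and [good_act_alt] make the commutator map
    bilinear and alternating over it; the last four say that the x_i and their
    commutators are bases.  In [good_act_mul] the two orders of composition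
    give commutativity.  The order of the factors in [good_span] is the one in
    which representatives are multiplied later. *)
Record good (G : groupType) (x : 'I_n -> G) : Prop := Good {
  good_nil2 : forall u v : G, central [~ u, v];
  good_act1 : forall s v, act x s 1 v -> central v;
  good_actM : forall s u v u' v',
    act x s u v -> act x s u' v' -> act x s (u * u') (v * v');
  good_actV : forall s u v, act x s u v -> act x s u^-1 v^-1;
  good_actD : forall s t u v v',
    act x s u v -> act x t u v' -> act x (s * t) u (v * v');
  good_actN : forall s u v, act x s u v -> act x s^-1 u v^-1;
  good_act_total : forall s, act x s 1 1 -> forall u, exists v, act x s u v;
  good_act_one : forall u, act x [~ x i0, x i1] u u;
  good_act_zero : forall u, act x 1 u 1;
  good_act_mul : forall s t, act x s 1 1 -> act x t 1 1 -> exists r,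
    forall u v w, (act x t u v -> act x s v w -> act x r u w) /\
                  (act x s u v -> act x t v w -> act x r u w);
  good_act_val : forall s v, act x s (x i0) v -> [~ v, x i1] = s;
  good_act_comm : forall s u v u' v',
    act x s u v -> act x s u' v' -> [~ v, u'] = [~ u, v'];
  good_act_alt : forall s u v, act x s u v -> [~ u, v] = 1;
  good_span : forall u : G, exists (s v : 'I_n -> G),
    (forall i, act x (s i) (x i) (v i)) /\
    central ((\prod_(i <- rev (enum 'I_n)) v i)^-1 * u);
  good_free : forall (s v : 'I_n -> G),
    (forall i, act x (s i) (x i) (v i)) ->
    central (\prod_(i <- rev (enum 'I_n)) v i) -> forall i, s i = 1;
  good_center_span : forall z, central z -> exists (s v : lt_idx n -> G),
    (forall p, act x (s p) (x (val p).1) (v p)) /\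
    z = \prod_p [~ v p, x (val p).2];
  good_center_free : forall (s v : lt_idx n -> G),
    (forall p, act x (s p) (x (val p).1) (v p)) ->
    \prod_p [~ v p, x (val p).2] = 1 -> forall p, s p = 1
}.

Definition params (G : groupType) (e : var -> G) : 'I_n -> G :=
  fun i => e (inr (0, i : nat)).

Lemma definable_good : definable (fun G e => good (params e)).
Proof.
(* The conjunction of all fields, read off from the type of the constructor. *)
pose axioms (G : groupType) (x : 'I_n -> G) : Prop :=
  ltac:(let rec conj T := lazymatch T with
          | ?A -> ?B => let C := conj B in constr:(A /\ C)
          | _ => constr:(True) end in
        let T := type of (@Good G x) in let C := conj T in exact C).
have goodE (G : groupType) (x : 'I_n -> G) : good x <-> axioms G x.
  split=> [[*]|]; first by do !split.
  by rewrite /axioms => H; decompose [and] H; constructor.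
apply: (definable_iff (fun G e => goodE G (params e))) => {goodE}.
rewrite /axioms /act /central /params {axioms}.
definable_tac 0.
exact: definable_true.
Qed.
End Good.

(** * The ring of scalars *)

Section Centre.
Local Open Scope group_scope.
Variable H : groupType.
Implicit Types u v z : H.

Lemma central1 : central (1 : H).
Proof. by move=> y; rewrite mul1g mulg1. Qed.

Lemma centralM z z' : central z -> central z' -> central (z * z').
Proof. by move=> zC z'C y; rewrite -mulgA z'C !mulgA zC. Qed.

Lemma centralV z : central z -> central z^-1.
Proof. by move=> zC y; apply: (mulgI z); rewrite mulVKg mulgA zC mulgK. Qed.

(** Two products of representatives are multiplied by moving [a'] to the left
    past [b]; [c] is the commutator that this costs, [c'] and [z] are the
    central corrections from the two remaining products. *)
Lemma mul_swap (a a' b b' ab ab' c c' z : H) : central c -> central c' ->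
  b * a' = a' * b * c -> a * a' = ab * c' -> b * b' = ab' * z ->
  a * b * (a' * b') = ab * ab' * (c' * z * c).
Proof.
move=> cC c'C ba aa bb.
rewrite mulgA -(mulgA a) ba !mulgA aa -mulgA (cC b') mulgA -(mulgA _ b) bb.
by rewrite !mulgA -(mulgA ab c') (c'C ab') !mulgA.
Qed.

Lemma mulM_central (a b c z w d : H) :
  central z -> a * b = c * d -> a * z * (b * w) = c * (d * (z * w)).
Proof. by move=> zC ab; rewrite -mulgA (mulgA z) (zC b) !mulgA ab. Qed.

(** The centre is written additively, so that products of commutators become
    ordinary finite sums. *)
Definition centre : Type := {z : H | `[<central z>]}.
HB.instance Definition _ := Choice.on centre.

Lemma centreP (z : centre) : central (val z).
Proof. exact/asboolP/(valP z). Qed.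

Definition in_centre z (zC : central z) : centre := exist _ z (asboolT zC).

Definition centre_add (z z' : centre) :=
  in_centre (centralM (centreP z) (centreP z')).
Definition centre_opp (z : centre) := in_centre (centralV (centreP z)).

Fact centre_addA : associative centre_add.
Proof. by move=> a b c; apply/val_inj; rewrite /= mulgA. Qed.
Fact centre_addC : commutative centre_add.
Proof. by move=> a b; apply/val_inj; rewrite /= centreP. Qed.
Fact centre_add0 : left_id (in_centre central1) centre_add.
Proof. by move=> a; apply/val_inj; rewrite /= mul1g. Qed.
Fact centre_addN : left_inverse (in_centre central1) centre_opp centre_add.
Proof. by move=> a; apply/val_inj; rewrite /= mulVg. Qed.
HB.instance Definition _ :=
  GRing.isZmodule.Build centre centre_addA centre_addC centre_add0 centre_addN.

Lemma val_centreD (z z' : centre) : val (z + z')%R = val z * val z'.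
Proof. by []. Qed.

Lemma val_centre_sum (I : Type) (r : seq I) (p : pred I) (F : I -> centre) :
  val (\sum_(i <- r | p i) F i)%R = \prod_(i <- r | p i) val (F i).
Proof. exact: (big_morph val val_centreD). Qed.

Lemma commg_eq u v z : u * v = v * u * z -> [~ u, v] = z.
Proof. by rewrite commgC => /mulgI. Qed.

Lemma central_commg z v : central z -> [~ z, v] = 1.
Proof. by move=> zC; apply: commg_eq; rewrite mulg1 zC. Qed.

Hypothesis nil2 : forall u v, central [~ u, v].

Definition comm u v : centre := in_centre (nil2 u v).

Lemma mul_comm u v : u * v = v * u * val (comm u v).
Proof. exact: commgC. Qed.

Lemma commMl u u' v : comm (u * u') v = (comm u v + comm u' v)%R.
Proof.
apply/val_inj/commg_eq; rewrite val_centreD /= -mulgA (commgC u' v) !mulgA.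
by rewrite (commgC u v) -(mulgA (v * u)) (nil2 u v u') !mulgA.
Qed.

Lemma comm_centl z v : central z -> comm z v = 0%R.
Proof. by move=> zC; apply/val_inj/central_commg. Qed.

Lemma comm_prod (I : Type) (r : seq I) (F : I -> H) v :
  comm (\prod_(i <- r) F i) v = (\sum_(i <- r) comm (F i) v)%R.
Proof.
apply: (big_morph (comm^~ v)) => [u u'|]; first exact: commMl.
exact: comm_centl central1.
Qed.

Lemma comm_congl u u' v : central (u^-1 * u') -> comm u v = comm u' v.
Proof.
by move=> C; rewrite -[u'](mulVKg u) commMl (comm_centl _ C) addr0.
Qed.

End Centre.

Section ScalarRing.
Local Open Scope group_scope.
Variables (n : nat) (i0 i1 : 'I_n) (H : groupType) (x : 'I_n -> H).
Hypothesis g : good i0 i1 x.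
Implicit Types u v w : H.

Local Notation act := (act i0 i1 x).

Let nil2 := good_nil2 g.
Local Notation comm := (comm nil2).

Lemma act_scal s u v : act s u v -> act s 1 1.
Proof.
by move=> suv; have := good_actM g suv (good_actV g suv); rewrite !mulgV.
Qed.

Lemma act_uniq s u v v' : act s u v -> act s u v' -> central (v^-1 * v').
Proof.
move=> suv suv'; apply: (good_act1 g (s := s)).
have := good_actM g (good_actV g suv) suv'; rewrite mulVg; apply.
Qed.

Lemma scal_central s : act s 1 1 -> central s.
Proof.
move=> /(good_act_total g)/(_ (x i0))[v /(good_act_val g) <-].
exact: nil2.
Qed.

(** The ring structure depends on the proof [g], hence the dummy argument. *)
Definition scal (_ : good i0 i1 x) : Type := {s : H | `[<act s 1 1>]}.
HB.instance Definition _ := Choice.on (scal g).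

Lemma scalP (s : scal g) : act (val s) 1 1.
Proof. exact/asboolP/(valP s). Qed.

Definition in_scal s (sS : act s 1 1) : scal g := exist _ s (asboolT sS).

Fact scal_addP (s t : scal g) : act (val s * val t) 1 1.
Proof. by rewrite -[X in act _ _ X]mul1g; apply: good_actD (scalP s) (scalP t). Qed.
Fact scal_oppP (s : scal g) : act (val s)^-1 1 1.
Proof. by rewrite -[X in act _ _ X]invg1; apply: good_actN (scalP s). Qed.

Definition scal_add s t := in_scal (scal_addP s t).
Definition scal_opp s := in_scal (scal_oppP s).
Definition scal_zero : scal g := in_scal (good_act_zero g 1).

Fact scal_addA : associative scal_add.
Proof. by move=> a b c; apply/val_inj; rewrite /= mulgA. Qed.
Fact scal_addC : commutative scal_add.
Proof. by move=> a b; apply/val_inj; rewrite /= (scal_central (scalP a)). Qed.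
Fact scal_add0 : left_id scal_zero scal_add.
Proof. by move=> a; apply/val_inj; rewrite /= mul1g. Qed.
Fact scal_addN : left_inverse scal_zero scal_opp scal_add.
Proof. by move=> a; apply/val_inj; rewrite /= mulVg. Qed.
HB.instance Definition _ :=
  GRing.isZmodule.Build (scal g) scal_addA scal_addC scal_add0 scal_addN.

Fact scale_ex (s : scal g) u : exists v, act (val s) u v.
Proof. exact: good_act_total g _ (scalP s) u. Qed.
Definition scale s u : H := sval (cid (scale_ex s u)).
Lemma scaleP s u : act (val s) u (scale s u).
Proof. by rewrite /scale; case: cid. Qed.

Fact scal_mul_ex (s t : scal g) : exists r : scal g, forall u v w,
  (act (val t) u v -> act (val s) v w -> act (val r) u w) /\
  (act (val s) u v -> act (val t) v w -> act (val r) u w).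
Proof.
have [r rP] := good_act_mul g (scalP s) (scalP t).
have rS := (rP 1 1 1).1 (scalP t) (scalP s).
by exists (in_scal rS).
Qed.
Definition scal_mul s t : scal g := sval (cid (scal_mul_ex s t)).
Lemma scal_mulP s t u v w :
  act (val t) u v -> act (val s) v w -> act (val (scal_mul s t)) u w.
Proof. by rewrite /scal_mul; case: cid => r rP; case: (rP u v w). Qed.
Lemma scal_mulP' s t u v w :
  act (val s) u v -> act (val t) v w -> act (val (scal_mul s t)) u w.
Proof. by rewrite /scal_mul; case: cid => r rP; case: (rP u v w). Qed.
Definition scal_one : scal g := in_scal (good_act_one g 1).

(** A scalar is determined by its action on x_0, so every ring identity below
    is checked by letting both sides act on x_0. *)
Lemma scal_eq (s t : scal g) v :
  act (val s) (x i0) v -> act (val t) (x i0) v -> s = t.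
Proof.
by move=> /(good_act_val g) vs /(good_act_val g); rewrite vs => /val_inj.
Qed.

Fact scal_mulA : associative scal_mul.
Proof.
move=> s t r; have rP := scaleP r (x i0); have tP := scaleP t (scale r (x i0)).
have sP := scaleP s (scale t (scale r (x i0))).
apply: (scal_eq (v := scale s (scale t (scale r (x i0))))).
  exact: scal_mulP (scal_mulP rP tP) sP.
exact: scal_mulP rP (scal_mulP tP sP).
Qed.
Fact scal_mulC : commutative scal_mul.
Proof.
move=> s t; have tP := scaleP t (x i0); have sP := scaleP s (scale t (x i0)).
apply: scal_eq (scal_mulP tP sP) (scal_mulP' tP sP).
Qed.
Fact scal_mul1 : left_id scal_one scal_mul.
Proof.
move=> s; have sP := scaleP s (x i0).
apply: (scal_eq _ sP); apply: (scal_mulP sP).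
exact: good_act_one.
Qed.
Fact scal_mulD : left_distributive scal_mul +%R.
Proof.
move=> s t r; have rP := scaleP r (x i0).
have sP := scaleP s (scale r (x i0)); have tP := scaleP t (scale r (x i0)).
apply: (scal_eq (v := scale s (scale r (x i0)) * scale t (scale r (x i0)))).
  have stP : act (val (s + t)%R) _ _ := good_actD g sP tP.
  exact: scal_mulP rP stP.
by have := good_actD g (scal_mulP rP sP) (scal_mulP rP tP).
Qed.
HB.instance Definition _ := GRing.Zmodule_isComPzRing.Build (scal g)
  scal_mulA scal_mulC scal_mul1 scal_mulD.

Lemma act_mul (s t : scal g) u v w :
  act (val t) u v -> act (val s) v w -> act (val (s * t)%R) u w.
Proof. exact: scal_mulP. Qed.

End ScalarRing.

Arguments scale {n i0 i1 H x} g s u.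
Arguments scaleP {n i0 i1 H x} g s u.
Arguments scalP {n i0 i1 H x} g s.
Arguments act_mul {n i0 i1 H x} g {s t u v w}.
Arguments scal_eq {n i0 i1 H x} g {s t v}.

(** * Coordinates *)

Section Coordinates.
Local Open Scope group_scope.
Variables (n : nat) (i0 i1 : 'I_n) (H : groupType) (x : 'I_n -> H).
Hypothesis g : good i0 i1 x.

Local Notation act := (act i0 i1 x).
Local Notation S := (scal g).
Let nil2 := good_nil2 g.
Local Notation comm := (comm nil2).
Local Notation Z := (centre H).

(** A representative of s x_i; the value 1 at 0 makes the cocycles below
    vanish when one argument is 0. *)
Definition rep i (s : S) : H := if s == 0%R then 1 else scale g s (x i).

Lemma repP i s : act (val s) (x i) (rep i s).
Proof.
rewrite /rep; case: eqP => [->|_]; last exact: scaleP.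
exact: good_act_zero.
Qed.

Lemma rep0 i : rep i 0%R = 1.
Proof. by rewrite /rep eqxx. Qed.

Fact rep_defect i s t : central ((rep i (s + t)%R)^-1 * (rep i s * rep i t)).
Proof.
apply: act_uniq (repP i (s + t)%R) _ => //.
by have := good_actD g (repP i s) (repP i t).
Qed.

(** The failure of additivity of [rep i], that is, the 2-cocycle of the
    extension of S^+ by the centre formed by the multiples of x_i. *)
Definition defect i s t : Z := in_centre (rep_defect i s t).

Lemma rep_mul i s t : rep i s * rep i t = rep i (s + t)%R * val (defect i s t).
Proof. by rewrite /= mulVKg. Qed.

(** The central element s [x_i, x_j]. *)
Definition rep_comm i j (s : S) : Z := comm (rep i s) (x j).

Lemma rep_commD i j : {morph rep_comm i j : s t / (s + t)%R}.
Proof.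
move=> s t; rewrite /rep_comm -commMl rep_mul commMl.
by rewrite (comm_centl _ _ (centreP (defect i s t))) addr0.
Qed.

Lemma rep_comm0 i j : rep_comm i j 0%R = 0%R.
Proof. by rewrite /rep_comm rep0 comm_centl //; apply: central1. Qed.

Lemma comm_act t u v u' v' : act (val (t : S)) u v -> act (val t) u' v' ->
  comm v u' = comm u v'.
Proof. by move=> tuv tuv'; apply/val_inj/(good_act_comm g tuv tuv'). Qed.

(** Bilinearity over S: the scalar t moves from the second argument to the
    first, where it is composed with s. *)
Lemma comm_rep_rep i j s t : comm (rep i s) (rep j t) = rep_comm i j (s * t)%R.
Proof.
have tP := scaleP g t (rep i s).
rewrite -(comm_act tP (repP j t)); apply: comm_congl.
apply: act_uniq (act_mul g (repP i s) tP) _ => //.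
by rewrite mulrC; apply: repP.
Qed.

(** The commutator of s x_i and t x_i is that of x_i and (st) x_i, which
    vanishes because the commutator map is alternating over S. *)
Lemma rep_commute i s t : rep i s * rep i t = rep i t * rep i s.
Proof.
rewrite (mul_comm nil2) comm_rep_rep (_ : rep_comm i i _ = 0%R) ?mulg1 //.
apply/val_inj => /=; rewrite -[LHS]invgR (good_act_alt g (repP i _)).
by rewrite invg1.
Qed.

Lemma defectC i s t : defect i s t = defect i t s.
Proof. by apply/val_inj; rewrite /= rep_commute addrC. Qed.

Lemma defect0 i s : defect i 0%R s = 0%R.
Proof. by apply/val_inj; rewrite /= rep0 mul1g add0r mulVg. Qed.

Lemma defectA i s t r :
  (defect i (s + t) r + defect i s t = defect i s (t + r) + defect i t r)%R.
Proof.
apply/val_inj/(mulgI (rep i (s + t + r)%R)); rewrite !val_centreD.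
rewrite mulgA -(rep_mul i (s + t)%R r) -mulgA -(centreP (defect i s t)) mulgA.
rewrite -(rep_mul i s t) -addrA mulgA -(rep_mul i s (t + r)%R) -[RHS]mulgA.
by rewrite -(rep_mul i t r) mulgA.
Qed.

(** The isomorphism from S^{pairs} to the centre given by the basis of the
    commutators [x_i, x_j]. *)
Definition of_coords (c : {ffun lt_idx n -> S}) : Z :=
  (\sum_p rep_comm (val p).1 (val p).2 (c p))%R.

Lemma of_coordsD : {morph of_coords : c d / (c + d)%R}.
Proof.
move=> c d; rewrite /of_coords -big_split /=.
by apply: eq_bigr => p _; rewrite ffunE rep_commD.
Qed.

Lemma of_coords0 : of_coords 0%R = 0%R.
Proof. by rewrite /of_coords big1 // => p _; rewrite ffunE rep_comm0. Qed.

Lemma of_coordsB : {morph of_coords : c d / (c - d)%R}.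
Proof.
move=> c d; apply: (addIr (of_coords d)); rewrite -of_coordsD !subrK //.
Qed.

Lemma of_coords_inj : injective of_coords.
Proof.
suff ker c : of_coords c = 0%R -> c = 0%R.
  move=> c d cd; apply/eqP; rewrite -subr_eq0; apply/eqP/ker.
  by rewrite of_coordsB cd subrr.
move=> /(congr1 val); rewrite val_centre_sum => c0.
apply/ffunP => p; rewrite ffunE; apply/val_inj.
exact: (good_center_free g (s := fun p => val (c p)) (fun p => repP _ _) c0 p).
Qed.

Fact of_coords_surj (z : Z) : exists c, of_coords c = z.
Proof.
have [s [v [sv zE]]] := good_center_span g (centreP z).
exists [ffun p => in_scal g (act_scal g (sv p))].
apply/val_inj; rewrite val_centre_sum zE; apply: eq_bigr => p _; rewrite ffunE.
rewrite -[LHS]/(val (comm _ _)) -[RHS]/(val (comm _ _)); congr val.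
have lP : act (s p) _ _ := repP (val p).1 (in_scal g (act_scal g (sv p))).
by apply: comm_congl; apply: (act_uniq g lP (sv p)).
Qed.

Definition coords (z : Z) : {ffun lt_idx n -> S} := sval (cid (of_coords_surj z)).
Lemma coordsK z : of_coords (coords z) = z.
Proof. by rewrite /coords; case: cid. Qed.

Definition cocycle (i : 'I_n) : sym_cocycle S {ffun lt_idx n -> S}.
Proof.
exists (fun s t => coords (defect i s t)).
- by move=> s; apply: of_coords_inj; rewrite coordsK defect0 of_coords0.
- by move=> s; apply: of_coords_inj; rewrite coordsK defectC defect0 of_coords0.
- by move=> s t r; apply: of_coords_inj; rewrite !of_coordsD !coordsK defectA.
- by move=> s t; rewrite defectC.
Defined.

Lemma of_coords_cocycle i s t : of_coords (cocycle i s t) = defect i s t.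
Proof. exact: coordsK. Qed.

(** Induction on the list: its head k exceeds all other indices, so moving the
    representative for k to the left contributes the commutators at (i, k) for
    the indices i of the tail, and nothing else. *)
Lemma rep_prodM (a b : 'I_n -> S) (l : seq 'I_n) :
  sorted (fun i j : 'I_n => (j < i)%N) l ->
  \prod_(i <- l) rep i (a i) * \prod_(i <- l) rep i (b i) =
  \prod_(i <- l) rep i (a i + b i)%R *
  val (\sum_(i <- l) defect i (a i) (b i) +
       \sum_(j <- l) \sum_(i <- l | (i < j)%N) rep_comm i j (a i * b j))%R.
Proof.
elim: l => [|k l IH]; first by rewrite !big_nil /= !mul1g.
rewrite [sorted _ _]/(path _ k l) => kl; have /IH{}IH := path_sorted kl.
have /allP lk : all (fun i : 'I_n => (i < k)%N) l.
  by apply: order_path_min kl => i j m /[swap]; apply: ltn_trans.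
set A := \prod_(i <- l) rep i (a i) in IH *.
set B := \prod_(i <- l) rep i (b i) in IH *.
rewrite !big_cons ltnn -/A -/B.
have -> : (\sum_(i <- l | (i < k)%N) rep_comm i k (a i * b k))%R = comm A (rep k (b k)).
  rewrite comm_prod big_seq_cond [RHS]big_seq; apply: eq_big => [i|i _].
    by apply/andb_idr/lk.
  by rewrite comm_rep_rep.
have -> : (\sum_(j <- l) \sum_(i <- k :: l | (i < j)%N) rep_comm i j (a i * b j))%R =
          (\sum_(j <- l) \sum_(i <- l | (i < j)%N) rep_comm i j (a i * b j))%R.
  by apply: eq_big_seq => j /lk jk; rewrite big_cons ltnNge ltnW.
set P := \prod_(i <- l) rep i (a i + b i)%R in IH *.
set c := comm A _; set d := defect k _ _.
set D := (\sum_(i <- l) defect _ _ _)%R in IH *.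
set E := (\sum_(i <- l) _)%R in IH *.
have -> : (d + D + (c + E) = d + (D + E) + c)%R by rewrite addrACA addrAC !addrA.
rewrite 2!val_centreD; apply: mul_swap (centreP c) (centreP d) _ _ IH.
  exact: mul_comm.
exact: rep_mul.
Qed.

(** The descending order matches the decreasing lists of [rep_prodM]. *)
Definition combine (c : N2 cocycle) : H :=
  \prod_(i <- rev (enum 'I_n)) rep i (c.1 i) * val (of_coords c.2).

(** The commutators collected in [rep_prodM] are the products a_i b_j of the
    multiplication law. *)
Lemma of_coords_outer (a b : 'I_n -> S) :
  of_coords [ffun p => a (val p).1 * b (val p).2]%R =
  (\sum_(j <- rev (enum 'I_n)) \sum_(i <- rev (enum 'I_n) | (i < j)%N)
     rep_comm i j (a i * b j))%R.
Proof.
rewrite (perm_big _ (permEl (perm_rev _))) big_enum /=.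
under eq_bigr do rewrite (perm_big _ (permEl (perm_rev _))) big_enum_cond /=.
rewrite (exchange_big_dep xpredT) //= pair_big_dep /=.
rewrite (big_sub (fun p : 'I_n * 'I_n => (p.1 < p.2)%N)
  (fun p => rep_comm p.1 p.2 (a p.1 * b p.2)%R)).
by rewrite /of_coords; apply: eq_bigr => p _; rewrite ffunE.
Qed.

Lemma combineM : {morph combine : c d / c * d}.
Proof.
move=> c d; rewrite /combine.
have -> : (c * d).2 = (c.2 + d.2 + [ffun p => c.1 (val p).1 * d.1 (val p).2] +
    \sum_k cocycle k (c.1 k) (d.1 k))%R.
  by apply/ffunP => p; rewrite !ffunE sum_ffunE.
under eq_bigr do rewrite ffunE.
rewrite !of_coordsD of_coords_outer (big_morph of_coords of_coordsD of_coords0).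
under [X in (_ + _ + _ + X)%R]eq_bigr do rewrite of_coords_cocycle.
have l_sorted : sorted (fun i j : 'I_n => (j < i)%N) (rev (enum 'I_n)).
  by rewrite rev_sorted; have := iota_ltn_sorted 0 n; rewrite -val_enum_ord sorted_map.
rewrite (mulM_central _ (centreP (of_coords c.2)) (rep_prodM c.1 d.1 l_sorted)).
have -> : (\sum_(i <- rev (enum 'I_n)) defect i (c.1 i) (d.1 i) =
           \sum_i defect i (c.1 i) (d.1 i))%R.
  by rewrite (perm_big _ (permEl (perm_rev _))) big_enum.
rewrite -!val_centreD; congr (_ * val _).
have E (p q r t : Z) : (p + q + r + t = t + r + (p + q))%R.
  by rewrite -addrA [RHS]addrC [(r + t)%R]addrC.
apply: E.
Qed.

Lemma combine_inj : injective combine.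
Proof.
suff ker c : combine c = 1 -> c = 1.
  move=> c d cd; apply: (mulIg d^-1); rewrite mulgV; apply: ker.
  rewrite combineM cd -combineM mulgV /combine /= of_coords0 mulg1 big1 // => i _.
  by rewrite ffunE rep0.
case: c => a b; rewrite /combine /= => ab1.
have a0 : a = 0%R.
  apply/ffunP => i; rewrite ffunE; apply/val_inj.
  apply: (good_free g (s := fun i => val (a i)) (fun i => repP i (a i))).
  rewrite -[X in central X](mulgK (val (of_coords b))) ab1 mul1g.
  exact/centralV/centreP.
congr pair => //; apply: of_coords_inj; rewrite of_coords0; apply/val_inj.
move: ab1; rewrite big1 ?mul1g // => i _; by rewrite a0 ffunE rep0.
Qed.

Lemma combine_surj u : exists c, combine c = u.
Proof.
have [s [v [sv uv]]] := good_span g u.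
pose a := [ffun i => in_scal g (act_scal g (sv i))].
have C : central ((\prod_(i <- rev (enum 'I_n)) rep i (a i))^-1 * u).
  set P := \prod_(i <- _) rep i _.
  have Pv : central (P^-1 * \prod_(i <- rev (enum 'I_n)) v i).
    apply: (big_rec2 (fun w w' => central (w^-1 * w'))) => [|i w w' _ ww'].
      by rewrite mulVg; apply: central1.
    have lP : act (s i) _ _ := repP i (in_scal g (act_scal g (sv i))).
    rewrite invgM -mulgA (mulgA _ (v i)) ffunE.
    by rewrite (act_uniq g lP (sv i)) mulgA; apply: centralM ww' (act_uniq g lP (sv i)).
  by have := centralM Pv uv; rewrite mulgA mulgK.
exists (a, coords (in_centre C)).
by rewrite /combine /= coordsK /= mulVKg.
Qed.

Lemma group_isomorphic_N2 : group_isomorphic H (N2 cocycle).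
Proof.
have /choice[phi phiK] := combine_surj.
have combineK c : phi (combine c) = c by apply: combine_inj.
have phiM : {morph phi : u v / u * v}.
  by move=> u v; apply: combine_inj; rewrite combineM !phiK.
pose phiMb := isMultiplicative.Build H (N2 cocycle) phi phiM.
pose phi' : {multiplicative H -> N2 cocycle} := HB.pack phi phiMb.
by exists phi', combine.
Qed.

End Coordinates.

(** * The groups N_{2,n}(R, f) *)

Lemma centralE (G : groupType) (z : G) : central z <-> forall y, [~ z, y]%g = 1%g.
Proof.
split=> [zC y|zC y]; first exact: central_commg.
by rewrite commgC zC mulg1.
Qed.

Section N2Facts.
Local Open Scope ring_scope.
Variables (n : nat) (R : comPzRingType).
Variable f : 'I_n -> sym_cocycle R {ffun lt_idx n -> R}.
Local Notation G := (N2 f).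
Implicit Types (u v w : G) (r : R).

(** The coordinate at (i, j) of the exterior product of [a] and [b]. *)
Definition minor (a b : {ffun 'I_n -> R}) i j := a i * b j - b i * a j.

Lemma fst1 i : (1%g : G).1 i = 0. Proof. by rewrite ffunE. Qed.
Lemma fstM u v i : (u * v)%g.1 i = u.1 i + v.1 i. Proof. by rewrite ffunE. Qed.
Lemma fstV u i : (u^-1)%g.1 i = - u.1 i. Proof. by rewrite ffunE. Qed.
Lemma fst_prod (I : Type) (l : seq I) (F : I -> G) i :
  (\prod_(k <- l) F k)%g.1 i = \sum_(k <- l) (F k).1 i.
Proof.
by apply: (big_morph (fun u : G => u.1 i)) => [u v|]; rewrite ?fstM ?fst1.
Qed.

Definition vert (c : {ffun lt_idx n -> R}) : G := (0, c).

Lemma vertD : {morph vert : c d / c + d >-> (c * d)%g}.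
Proof.
move=> c d; congr pair; apply/ffunP => i; rewrite !ffunE ?addr0 //= mul0r addr0.
by rewrite big1 ?addr0 // => k _; rewrite !ffunE cocycle0x ffunE.
Qed.

Lemma vert_prod (I : finType) (F : I -> {ffun lt_idx n -> R}) :
  vert (\sum_i F i) = (\prod_i vert (F i))%g.
Proof. exact: (big_morph vert vertD). Qed.

Lemma mul_vert u c : (u * vert c)%g = (u.1, u.2 + c) :> G.
Proof.
congr pair; apply/ffunP => i; rewrite !ffunE ?addr0 //= mulr0 addr0.
by rewrite big1 ?addr0 // => k _; rewrite !ffunE cocyclex0 ffunE.
Qed.

Lemma commE u v :
  [~ u, v]%g = vert [ffun p => minor u.1 v.1 (val p).1 (val p).2].
Proof.
apply: commg_eq; rewrite mul_vert; congr pair; apply/ffunP => i; rewrite !ffunE.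
  by rewrite addrC.
under eq_bigr do rewrite cocycleC.
by rewrite /minor; ring.
Qed.

(** A minor changes sign when its indices are exchanged, so the coordinates
    at i < j determine all of them. *)
Lemma minor_total (a b c d : {ffun 'I_n -> R}) :
  (forall p : lt_idx n, minor a b (val p).1 (val p).2 = minor c d (val p).1 (val p).2)
  <-> forall i j, minor a b i j = minor c d i j.
Proof.
split=> [H i j|H p //]; case: (ltngtP i j) => [ij|ji|/val_inj->].
- exact: (H (exist _ (i, j) ij)).
- have := H (exist _ (j, i) ji); rewrite /minor /= => E.
  rewrite [LHS](_ : _ = - (a j * b i - b j * a i)); last by ring.
  by rewrite E; ring.
- by rewrite /minor; ring.
Qed.

Lemma comm_eqP u v u' v' :
  [~ u, v]%g = [~ u', v']%g <-> forall i j, minor u.1 v.1 i j = minor u'.1 v'.1 i j.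
Proof.
rewrite -minor_total !commE; split=> [[/ffunP H] p|H].
  by have := H p; rewrite !ffunE.
by congr vert; apply/ffunP => p; rewrite !ffunE.
Qed.

Lemma comm_eq1 u v :
  [~ u, v]%g = 1%g <-> forall i j, minor u.1 v.1 i j = 0.
Proof.
rewrite -(commg1 1%g) comm_eqP; split=> H i j; rewrite H /minor !fst1; ring.
Qed.

Lemma vert_central c : central (vert c).
Proof. by apply/centralE => y; apply/comm_eq1 => i j; rewrite /minor !ffunE; ring. Qed.

Definition delta i : {ffun 'I_n -> R} := [ffun j => (j == i)%:R].
Definition hor (a : {ffun 'I_n -> R}) : G := (a, 0).

Lemma idx_eq (p q : lt_idx n) :
  (q == p)%:R = ((val q).1 == (val p).1)%:R * ((val q).2 == (val p).2)%:R :> R.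
Proof. by rewrite -natrM mulnb. Qed.

Lemma idx_swap (p q : lt_idx n) :
  ((val q).1 == (val p).2)%:R * ((val q).2 == (val p).1)%:R = 0 :> R.
Proof.
rewrite -natrM mulnb; case: andP => // -[/eqP E1 /eqP E2].
by have := valP q; rewrite E1 E2 ltnNge ltnW //; apply: (valP p).
Qed.

Variables (i0 i1 : 'I_n).
Hypothesis i01 : (i0 < i1)%N.

Let i10 : (i1 == i0) = false. Proof. by rewrite -val_eqE /= gtn_eqF. Qed.

(** Commuting with the unit vector at k forces all coordinates other than
    the one at k to vanish; two different k leave nothing. *)
Lemma fst_central u : central u -> u.1 = 0.
Proof.
move=> /centralE uC; apply/ffunP => j; rewrite ffunE.
have H k i := (comm_eq1 _ _).1 (uC (hor (delta k))) j i.
case: (eqVneq j i1) => [E|ji1].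
  by have := H i0 i0; rewrite /minor !ffunE eqxx E i10 mulr1 mul0r subr0.
by have := H i1 i1; rewrite /minor !ffunE eqxx (negPf ji1) mulr1 mul0r subr0.
Qed.

Lemma centralP u : central u <-> u.1 = 0.
Proof.
split; first exact: fst_central.
by case: u => a c /= ->; apply: vert_central.
Qed.

Lemma cong_fst u v : central (u^-1 * v)%g -> u.1 = v.1.
Proof.
move=> /centralP E; apply/ffunP => i; apply/esym/eqP; rewrite -subr_eq0 addrC.
by rewrite -fstV -fstM E ffunE.
Qed.

Definition p01 : lt_idx n := exist _ (i0, i1) i01.
Definition vert01 r : G := vert [ffun p => (p == p01)%:R * r].
Definition std (i : 'I_n) : G := hor (delta i).

Lemma vert01D r r' : vert01 (r + r') = (vert01 r * vert01 r')%g.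
Proof.
by rewrite -vertD; congr vert; apply/ffunP => p; rewrite !ffunE mulrDr.
Qed.
Lemma vert01_0 : vert01 0 = 1%g.
Proof.
by rewrite /vert01 (_ : [ffun p => _] = 0) //; apply/ffunP => p; rewrite !ffunE mulr0.
Qed.
Lemma vert01N r : vert01 (- r) = (vert01 r)^-1%g.
Proof. by apply: (mulIg (vert01 r)); rewrite mulVg -vert01D addNr vert01_0. Qed.
Lemma vert01_inj : injective vert01.
Proof. by move=> r r' [/ffunP/(_ p01)]; rewrite !ffunE eqxx !mul1r. Qed.

Definition multiple r u v := forall i, v.1 i = r * u.1 i.

Lemma p01E p : (p == p01)%:R = ((val p).1 == i0)%:R * ((val p).2 == i1)%:R :> R.
Proof. exact: idx_eq p01 p. Qed.

Lemma p10E (p : lt_idx n) :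
  ((val p).1 == i1)%:R * ((val p).2 == i0)%:R = 0 :> R.
Proof. exact: idx_swap p01 p. Qed.

Lemma minor_hor_std r (p q : lt_idx n) :
  minor [ffun j => r * (j == (val p).1)%:R] (delta (val p).2) (val q).1 (val q).2
  = r * (q == p)%:R.
Proof.
rewrite idx_eq /minor !ffunE.
by rewrite -[RHS]subr0 -[X in _ = _ - X](mulr0 r) -(idx_swap p q); ring.
Qed.

(** Commuting with x_0 (resp. x_1) makes the witness [w0] (resp. [w1]) a
    multiple of the unit vector, and both multiples are by the scalar that [s]
    carries in the coordinate (0, 1).  The remaining two equations compare
    minors, and the minors of a unit vector give all coordinates but one. *)
Lemma act_std s u v :
  act i0 i1 std s u v <-> exists r, s = vert01 r /\ multiple r u v.
Proof.
split=> [[w0 [w1 [/comm_eq1 c0 [/comm_eq1 c1 [s0 [s1 [/comm_eqP u0 /comm_eqP u1]]]]]]]|].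
  have {}c0 j : w0.1 j = (j == i0)%:R * w0.1 i0.
    case: (eqVneq j i0) => [->|ji]; first by rewrite mul1r.
    have := c0 j i0; rewrite /minor !ffunE eqxx (negPf ji) /= => E.
    by rewrite mul0r -[RHS]E; ring.
  have {}c1 j : w1.1 j = (j == i1)%:R * w1.1 i1.
    case: (eqVneq j i1) => [->|ji]; first by rewrite mul1r.
    have := c1 j i1; rewrite /minor !ffunE eqxx (negPf ji) /= => E.
    by rewrite mul0r -[RHS]E; ring.
  have {}s0 : s = vert01 (w0.1 i0).
    rewrite -s0 commE; congr vert; apply/ffunP => p; rewrite !ffunE p01E /minor !ffunE.
    rewrite (c0 (val p).1) (c0 (val p).2).
    transitivity (((val p).1 == i0)%:R * ((val p).2 == i1)%:R * w0.1 i0 -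
      (((val p).1 == i1)%:R * ((val p).2 == i0)%:R) * w0.1 i0); first by ring.
    by rewrite p10E; ring.
  have {}s1 : s = vert01 (w1.1 i1).
    rewrite -s1 commE; congr vert; apply/ffunP => p; rewrite !ffunE p01E /minor !ffunE.
    rewrite (c1 (val p).1) (c1 (val p).2).
    transitivity (((val p).1 == i0)%:R * ((val p).2 == i1)%:R * w1.1 i1 -
      (((val p).1 == i1)%:R * ((val p).2 == i0)%:R) * w1.1 i1); first by ring.
    by rewrite p10E; ring.
  (* The coordinate at i0 is visible only through the commutator with x_1. *)
  exists (w0.1 i0); split=> // j; case: (eqVneq j i0) => [->|ji].
    have := u1 i1 i0; rewrite /minor !ffunE eqxx (eq_sym i0) i10 (c1 i0).
    rewrite (eq_sym i0) i10 /= !mul0r !mulr0 !subr0 mul1r => <-; congr (_ * _).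
    by apply: vert01_inj; rewrite -s0 -s1.
  have := u0 i0 j; rewrite /minor !ffunE eqxx (negPf ji) (c0 j) (negPf ji) /=.
  by rewrite !mul0r !mulr0 !subr0 mul1r => <-.
move=> [r [-> uv]].
exists (hor [ffun j => r * (j == i0)%:R]), (hor [ffun j => r * (j == i1)%:R]).
do 5?split.
- by apply/comm_eq1 => i j; rewrite /minor !ffunE; ring.
- by apply/comm_eq1 => i j; rewrite /minor !ffunE; ring.
- rewrite commE; congr vert; apply/ffunP => p; rewrite !ffunE p01E /minor !ffunE.
  rewrite -[RHS]subr0 -[X in _ = _ - X](mulr0 r) -(p10E p); ring.
- rewrite commE; congr vert; apply/ffunP => p; rewrite !ffunE p01E /minor !ffunE.
  rewrite -[RHS]subr0 -[X in _ = _ - X](mulr0 r) -(p10E p); ring.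
- by apply/comm_eqP => i j; rewrite /minor !ffunE !uv; ring.
- by apply/comm_eqP => i j; rewrite /minor !ffunE !uv; ring.
Qed.

Lemma good_std : good i0 i1 std.
Proof.
split.
- by move=> u v; rewrite commE; apply: vert_central.
- move=> s v /act_std[r [_ uv]]; apply/centralP/ffunP => i.
  by rewrite uv [RHS]ffunE fst1 mulr0.
- move=> s u v u' v' /act_std[r [-> uv]] /act_std[r' [/vert01_inj <- uv']].
  by apply/act_std; exists r; split=> // i; rewrite !fstM uv uv' mulrDr.
- move=> s u v /act_std[r [-> uv]].
  by apply/act_std; exists r; split=> // i; rewrite !fstV uv mulrN.
- move=> s t u v v' /act_std[r [-> uv]] /act_std[r' [-> uv']].
  apply/act_std; exists (r + r'); split=> [|i]; first by rewrite vert01D.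
  by rewrite fstM uv uv' mulrDl.
- move=> s u v /act_std[r [-> uv]].
  apply/act_std; exists (- r); split=> [|i]; first by rewrite vert01N.
  by rewrite fstV uv mulNr.
- move=> s /act_std[r [-> _]] u; exists (hor [ffun i => r * u.1 i]).
  by apply/act_std; exists r; split=> // i; rewrite ffunE.
- move=> u; apply/act_std; exists 1; split=> [|i]; last by rewrite mul1r.
  rewrite commE; congr vert; apply/ffunP => p; rewrite !ffunE p01E /minor !ffunE.
  by rewrite p10E; ring.
- move=> u; apply/act_std; exists 0; split=> [|i]; first by rewrite vert01_0.
  by rewrite fst1 mul0r.
- move=> s t /act_std[r [-> _]] /act_std[r' [-> _]]; exists (vert01 (r * r')).
  move=> u v w; split=> /act_std[a [/vert01_inj <- uv]] /act_std[b [/vert01_inj <- vw]].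
    by apply/act_std; exists (r * r'); split=> // i; rewrite vw uv mulrA.
  by apply/act_std; exists (r * r'); split=> // i; rewrite vw uv mulrCA mulrA.
- move=> s v /act_std[r [-> uv]].
  rewrite commE; congr vert; apply/ffunP => p; rewrite !ffunE p01E /minor !uv !ffunE.
  rewrite -[RHS]subr0 -[X in _ = _ - X](mulr0 r) -(p10E p); ring.
- move=> s u v u' v' /act_std[r [-> uv]] /act_std[r' [/vert01_inj <- uv']].
  by apply/comm_eqP => i j; rewrite /minor !uv !uv'; ring.
- move=> s u v /act_std[r [_ uv]].
  by apply/comm_eq1 => i j; rewrite /minor !uv; ring.
- move=> u; exists (fun i => vert01 (u.1 i)).
  exists (fun i => hor [ffun j => u.1 i * (j == i)%:R]).
  split=> [i|].
    by apply/act_std; exists (u.1 i); split=> // j; rewrite !ffunE.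
  apply/centralP/ffunP => i; rewrite fstM fstV fst_prod ffunE.
  rewrite (perm_big _ (permEl (perm_rev _))) big_enum /= (bigD1 i) //= ffunE eqxx.
  rewrite big1 ?addr0 ?mulr1 ?addNr // => j ji; rewrite ffunE.
  by rewrite eq_sym (negPf ji) mulr0.
- move=> s v sv /centralP C i; have /act_std[r [-> uv]] := sv i.
  move/ffunP: C => /(_ i); rewrite fst_prod.
  rewrite (perm_big _ (permEl (perm_rev _))) big_enum /=.
  rewrite (bigD1 i) //= big1 ?addr0 => [|j ji].
    by rewrite uv !ffunE eqxx mulr1 => ->; rewrite vert01_0.
  by have /act_std[r' [_ ->]] := sv j; rewrite ffunE eq_sym (negPf ji) mulr0.
- move=> z /centralP z0.
  exists (fun p => vert01 (z.2 p)).
  exists (fun p => hor [ffun j => z.2 p * (j == (val p).1)%:R]).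
  split=> [p|].
    by apply/act_std; exists (z.2 p); split=> // j; rewrite !ffunE.
  transitivity (vert z.2); first by case: z z0 => a c /= ->.
  under eq_bigr do rewrite commE.
  rewrite -vert_prod; congr vert; apply/ffunP => q; rewrite sum_ffunE.
  rewrite (bigD1 q) //= big1 ?addr0 => [|p pq]; rewrite !ffunE minor_hor_std.
    by rewrite eqxx mulr1.
  by rewrite eq_sym (negPf pq) mulr0.
- move=> s v sv E p; have /choice[r rP] := fun p => (act_std _ _ _).1 (sv p).
  have [-> _] := rP p; suff -> : r p = 0 by rewrite vert01_0.
  have vE q : [~ v q, std (val q).2]%g = vert [ffun p' => r q * (p' == q)%:R].
    rewrite commE; congr vert; apply/ffunP => p'; rewrite !ffunE -minor_hor_std /minor.
    by rewrite !(rP q).2 !ffunE.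
  move: E; under eq_bigr do rewrite vE.
  rewrite -vert_prod => -[/ffunP/(_ p)]; rewrite sum_ffunE (bigD1 p) //= big1 => [|q pq].
    by rewrite !ffunE eqxx addr0 mulr1.
  by rewrite ffunE eq_sym (negPf pq) mulr0.
Qed.

End N2Facts.

(** * Scalars of an arbitrary good tuple of N_{2,n}(R, f) *)

Section ScalarsOfN2.
Local Open Scope ring_scope.
Variables (n : nat) (R : comPzRingType).
Variable f : 'I_n -> sym_cocycle R {ffun lt_idx n -> R}.
Local Notation G := (N2 f).
Variables (i0 i1 : 'I_n).
Hypothesis i01 : (i0 < i1)%N.
Variable x : 'I_n -> G.
Hypothesis g : good i0 i1 x.
Local Notation S := (scal g).
Implicit Types (u v w : G) (r : R).

Definition smul r u : G := hor f [ffun j => r * u.1 j].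

Lemma smulP r u : multiple r u (smul r u).
Proof. by move=> i; rewrite ffunE. Qed.

(** The exterior square is R-bilinear, so the witnesses can be taken to be
    r x_0 and r x_1 whatever the tuple x is. *)
Lemma act_smul r u v : multiple r u v ->
  act i0 i1 x [~ smul r (x i0), x i1]%g u v.
Proof.
move=> uv; exists (smul r (x i0)), (smul r (x i1)); do 5?split => //.
- by apply/comm_eq1 => i j; rewrite /minor !smulP; ring.
- by apply/comm_eq1 => i j; rewrite /minor !smulP; ring.
- by apply/comm_eqP => i j; rewrite /minor !smulP; ring.
- by apply/comm_eqP => i j; rewrite /minor !smulP !uv; ring.
- by apply/comm_eqP => i j; rewrite /minor !smulP !uv; ring.
Qed.

Fact scalar_subproof r : act i0 i1 x [~ smul r (x i0), x i1]%g 1%g 1%g.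
Proof. by apply: act_smul => i; rewrite !fst1 mulr0. Qed.

Definition scalar r : S := in_scal g (scalar_subproof r).

Lemma act_scalar r u v : multiple r u v -> act i0 i1 x (val (scalar r)) u v.
Proof. exact: act_smul. Qed.

(** Let phi be the action of s.  Since [u, phi u] = 1 for the unit vectors,
    phi maps the i-th unit vector to a_i times itself.  Comparing
    [phi u, e_j] = [u, phi e_j] at the coordinate (i, j) gives
    (phi u)_i = a_j u_i for i <> j; with u = e_i this shows that all a_j
    are equal. *)
Lemma act_is_multiple (s : S) : exists r, forall u v, act i0 i1 x (val s) u v ->
  multiple r u v.
Proof.
pose a i := (scale g s (std f i)).1 i.
have diag i j : (scale g s (std f i)).1 j = (j == i)%:R * a i.
  case: (eqVneq j i) => [->|ji]; first by rewrite mul1r.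
  have /comm_eq1/(_ i j) := good_act_alt g (scaleP g s (std f i)).
  by rewrite /minor !ffunE eqxx (negPf ji) mul1r mulr0 subr0 mul0r.
(* The coordinate at (i, j) of [phi u, e_j] = [u, phi e_j]. *)
have off u v i j : act i0 i1 x (val s) u v -> i != j -> v.1 i = a j * u.1 i.
  move=> suv ij.
  have /comm_eqP/(_ i j) := good_act_comm g suv (scaleP g s (std f j)).
  rewrite /minor !ffunE !diag eqxx (negPf ij) /= mulr1 !mul0r subr0.
  by rewrite mul1r subr0 mulrC.
have i01' : i0 != i1 by rewrite -val_eqE /= ltn_eqF.
have a01 : a i1 = a i0.
  have := off _ _ i1 i0 (scaleP g s (std f i1)).
  by rewrite diag ffunE eqxx mul1r mulr1; apply; rewrite eq_sym.
exists (a i0) => u v suv i; have [->|ii0] := eqVneq i i0.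
  by rewrite -a01; apply: off suv _.
exact: off suv ii0.
Qed.

Lemma scalar_surj (s : S) : exists r, scalar r = s.
Proof.
have [r rP] := act_is_multiple s; exists r.
have sP := scaleP g s (x i0).
exact: (scal_eq g (act_scalar (rP _ _ sP)) sP).
Qed.

Lemma scalar_inj : injective scalar.
Proof.
move=> r r' E.
have H := act_scalar (smulP r (std f i0)); have H' := act_scalar (smulP r' (std f i0)).
rewrite E in H; have := cong_fst i01 (act_uniq g H H').
move/(congr1 (fun a : {ffun _} => a i0)).
by rewrite !ffunE eqxx !mulr1.
Qed.

Lemma scalarD r r' : scalar (r + r') = scalar r + scalar r'.
Proof.
have H : act i0 i1 x (val (scalar r + scalar r')) _ _ :=
  good_actD g (act_scalar (smulP r (x i0))) (act_scalar (smulP r' (x i0))).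
apply: (scal_eq g _ H); apply: act_scalar => i.
by rewrite fstM !smulP mulrDl.
Qed.

Lemma scalarN r : scalar (- r) = - scalar r.
Proof.
have H : act i0 i1 x (val (- scalar r)) _ _ := good_actN g (act_scalar (smulP r (x i0))).
by apply: (scal_eq g _ H); apply: act_scalar => i; rewrite fstV smulP mulNr.
Qed.

Lemma scalar0 : scalar 0 = 0.
Proof. by rewrite -(subrr 0) scalarD scalarN subrr. Qed.

Lemma scalar1 : scalar 1 = 1.
Proof.
have H : act i0 i1 x (val (1 : S)) _ _ := good_act_one g (x i0).
by apply: (scal_eq g _ H); apply: act_scalar => i; rewrite mul1r.
Qed.

Lemma scalarM r r' : scalar (r * r') = scalar r * scalar r'.
Proof.
have H := act_mul g (act_scalar (smulP r' (x i0))) (act_scalar (smulP r _)).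
by apply: (scal_eq g _ H); apply: act_scalar => i; rewrite !smulP mulrA.
Qed.

(** Whatever the good tuple, [scalar] is an isomorphism from R onto its ring of
    scalars; this makes the choice of the good tuple harmless. *)
Lemma models_scalar (phi : formula ring_sig) :
  models (ring_structure R) phi <-> models (ring_structure S) phi.
Proof.
have iso := @holds_iso ring_sig (ring_structure R) (ring_structure S) scalar
  scalar_surj scalar_inj.
have {}iso : forall e : nat -> R, holds (M := ring_structure R) e phi <->
    holds (M := ring_structure S) (scalar \o e) phi.
  apply: iso => [[] a /=|[]].
  - exact: scalar0.
  - exact: scalar1.
  - exact: scalarD.
  - exact: scalarN.
  - exact: scalarM.
split=> Hm e; last by apply/iso.
have /choice[h hK] := scalar_surj.
have -> : e = scalar \o (h \o e) by apply/funext => v /=; rewrite hK.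
by apply/iso.
Qed.

End ScalarsOfN2.

(** * Interpretation of ring formulas *)

Section Interpretation.
Variables (n : nat) (i0 i1 : 'I_n).
Local Notation params := (@params n).
Local Notation good := (good i0 i1).
Local Open Scope group_scope.

(** A ring variable ranges over the whole group: elements that represent no
    scalar are read as 0.  Quantifiers of ring formulas then need no
    relativization. *)
Definition retract (H : groupType) (x : 'I_n -> H) (g : good x) (a : H) : scal g :=
  if pselect (act i0 i1 x a 1 1) is left aS then in_scal g aS else 0%R.

Lemma retractK (H : groupType) (x : 'I_n -> H) (g : good x) (s : scal g) :
  retract g (val s) = s.
Proof.
rewrite /retract; case: pselect => [?|[]]; last exact: scalP.
exact/val_inj.
Qed.

(** Slot 1 holds the values of the ring variables. *)
Definition scal_env (H : groupType) (e : var -> H) (g : good (params e)) :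
    nat -> ring_structure (scal g) :=
  fun v => retract g (e (inr (1%N, v))).

Definition term_val (t : term ring_sig) (H : groupType) (e : var -> H) (b : H) :=
  exists g : good (params e),
    b = val (eval (M := ring_structure (scal g)) (scal_env g) t).

(** The value of a subterm is always described by a formula about the variable
    20; equating 20 with another variable moves that description elsewhere. *)
Lemma definable_rename k (P : forall H : groupType, (var -> H) -> H -> Prop) :
  k != 20%N ->
  (forall H e v b a, P H (upd e (inl v) b) a <-> P H e a) ->
  definable (fun H e => P H e (e (inl 20%N))) ->
  definable (fun H e => P H e (e (inl k))).
Proof.
move=> k20 Pv Pdef.
have : definable (fun H e => exists a, P H e a /\ e (inl k) = a).
  apply: (@definable_ex (inl 20%N) (fun H e a => P H e a /\ e (inl k) = a)).
    move=> H e b a; rewrite Pv /upd.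
    by rewrite -[inl k == _]/(k == 20%N) (negPf k20).
  by apply: definable_and => //; apply: definable_eq; apply: definable_var.
by apply: definable_iff => H e; split=> [?|[a [? ->]]] //; exists (e (inl k)).
Qed.

(** Ring multiplication is not a group term, so a ring term is described by
    its graph, with the values of the immediate subterms in the variables 21
    and 22. *)
Lemma definable_term_val t : definable (fun H e => term_val t e (e (inl 20%N))).
Proof.
have sub u k : k != 20%N ->
    definable (fun H e => term_val u e (e (inl 20%N))) ->
    definable (fun H e => term_val u e (e (inl k))).
  by move=> k20; apply: (definable_rename k20).
elim: t => [v|[] a IH].
- apply: (@definable_iff _ (fun H e => good (params e) /\
    ((act i0 i1 (params e) (e (inr (1%N, v))) 1 1 /\ e (inl 20%N) = e (inr (1%N, v))) \/
     ((act i0 i1 (params e) (e (inr (1%N, v))) 1 1 -> False) /\ e (inl 20%N) = 1)))).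
    move=> H e; split.
      case=> g ->; split=> //=; rewrite /scal_env /retract.
      by case: pselect => aS; [left | right].
    case=> g H'; exists g; rewrite /= /scal_env /retract.
    by case: pselect H' => aS [] [].
  apply: definable_and (definable_good i0 i1) _.
  rewrite /act /params; definable_tac 0%N; definable_term_tac.
- apply: (@definable_iff _ (fun H e => good (params e) /\ e (inl 20%N) = 1)).
    by move=> H e; split; case=> g E; [split | exists g]; rewrite // E.
  apply: definable_and (definable_good i0 i1) _.
  definable_tac 0%N.
- apply: (@definable_iff _ (fun H e => good (params e) /\
      e (inl 20%N) = [~ params e i0, params e i1])).
    by move=> H e; split; case=> g E; [split | exists g]; rewrite // E.
  apply: definable_and (definable_good i0 i1) _.
  rewrite /params; definable_tac 0%N.
- apply: (@definable_iff _ (fun H e => exists b, term_val (a ord0) e b /\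
      exists c, term_val (a ord_max) e c /\ e (inl 20%N) = b * c)).
    move=> H e; split.
      by case=> g ->; do 2!(eexists; split; first by exists g).
    case=> b [[g ->] [c [[g' ->] ->]]]; exists g.
    by rewrite (Prop_irrelevance g' g).
  apply: (@definable_ex (inl 21%N)) => //; apply: definable_and; first exact: sub.
  apply: (@definable_ex (inl 22%N)) => //; apply: definable_and; first exact: sub.
  definable_tac 0%N.
- apply: (@definable_iff _ (fun H e => exists b, term_val (a ord0) e b /\
      e (inl 20%N) = b^-1)).
    move=> H e; split.
      by case=> g ->; eexists; split; first by exists g.
    by case=> b [[g ->] ->]; exists g.
  apply: (@definable_ex (inl 21%N)) => //; apply: definable_and; first exact: sub.
  definable_tac 0%N.
- apply: (@definable_iff _ (fun H e => exists b, term_val (a ord0) e b /\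
      exists c, term_val (a ord_max) e c /\ exists v w : H,
        act i0 i1 (params e) c (params e i0) v /\ act i0 i1 (params e) b v w /\
        e (inl 20%N) = [~ w, params e i1])).
    have mulE (H : groupType) (x : 'I_n -> H) (g : good x) (s t : scal g) v w :
        act i0 i1 x (val t) (x i0) v -> act i0 i1 x (val s) v w ->
        val (s * t)%R = [~ w, x i1].
      by move=> tv sw; rewrite (good_act_val g (act_mul g tv sw)).
    move=> H e; split.
      case=> g ->; do 2!(eexists; split; first by exists g).
      set s := eval _ (a ord0); set t := eval _ (a ord_max).
      have tP := scaleP g t (params e i0).
      have sP := scaleP g s (scale g t (params e i0)).
      by do 2!eexists; split; [exact: tP | split; [exact: sP | exact: mulE tP sP]].
    case=> b [[g ->] [c [[g' ->] [v [w [tP [sP ->]]]]]]]; exists g.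
    by rewrite (Prop_irrelevance g' g) in tP; rewrite /= (mulE _ _ _ _ _ _ _ tP sP).
  apply: (@definable_ex (inl 21%N)) => //; apply: definable_and; first exact: sub.
  apply: (@definable_ex (inl 22%N)) => //; apply: definable_and; first exact: sub.
  rewrite /act /params; definable_tac 0%N.
Qed.

Definition interp (phi : formula ring_sig) (H : groupType) (e : var -> H) :=
  exists g : good (params e), holds (M := ring_structure (scal g)) (scal_env g) phi.

Lemma definable_interp phi : definable (interp phi).
Proof.
have updE (H : groupType) (e : var -> H) (g : good (params e)) v a :
    @scal_env H (upd e (inr (1%N, v)) a) g = [eta scal_env g with v |-> retract g a].
  apply/funext => w; rewrite /scal_env /upd /=.
  by rewrite -[inr _ == _]/(w == v); case: eqP.
elim: phi => [t u|[]||p IHp q IHq|p IHp q IHq|p IHp q IHq|v p IH|v p IH].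
- apply: (@definable_iff _ (fun H e => exists a, term_val t e a /\ term_val u e a)).
    move=> H e; split=> [[g E]|[a [[g ->] [g' E]]]].
      by eexists; split; exists g; first reflexivity; rewrite -[LHS]/(val _) E.
    by exists g; apply/val_inj; rewrite E (Prop_irrelevance g' g).
  apply: (@definable_ex (inl 20%N)) => //.
  by apply: definable_and; apply: definable_term_val.
- by apply: definable_iff definable_false => H e; split=> // -[].
- apply: definable_iff (definable_and IHp IHq) => H e.
  split=> [[g [? ?]]|[[g ?] [g' +]]]; first by split; exists g.
  by rewrite (Prop_irrelevance g' g); exists g.
- apply: definable_iff (definable_or IHp IHq) => H e.
  split=> [[g [?|?]]|[[g ?]|[g ?]]].
  - by left; exists g.
  - by right; exists g.
  - by exists g; left.
  - by exists g; right.
- apply: definable_iff (definable_and (definable_good i0 i1)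
    (definable_imp IHp IHq)) => H e.
  split=> [[g pq]|[g pq]].
    by split=> // -[g']; rewrite (Prop_irrelevance g' g) => /pq; exists g.
  exists g => pg; have [|g'] := pq; first by exists g.
  by rewrite (Prop_irrelevance g' g).
- apply: definable_iff (definable_and (definable_good i0 i1)
    (definable_updA (inr (1%N, v)) IH)) => H e.
  split=> [[g pg]|[g pg]].
    by split=> // a; exists g; rewrite updE; apply: pg.
  exists g => s; have [g'] := pg (val s).
  by rewrite (Prop_irrelevance g' g) updE retractK.
- apply: definable_iff (definable_updE (inr (1%N, v)) IH) => H e.
  split=> [[g [s sp]]|[a [g]]].
    by exists (val s), g; rewrite updE retractK.
  by rewrite updE => ?; exists g, (retract g a).
Qed.

End Interpretation.

(** * Groups elementarily equivalent to N_{2,n}(R, f) *)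

Theorem theorem6p8 (n : nat) (R : comPzRingType)
    (f : 'I_n -> sym_cocycle R {ffun lt_idx n -> R}) (H : groupType) :
  (2 <= n)%N ->
  elem_equiv (group_structure H) (group_structure (N2 f)) ->
  exists (S : comPzRingType) (q : 'I_n -> sym_cocycle S {ffun lt_idx n -> S}),
    elem_equiv (ring_structure R) (ring_structure S)
    /\ group_isomorphic H (N2 q).
Proof.
move=> n2 HG.
pose i0 : 'I_n := Ordinal (ltnW n2); pose i1 : 'I_n := Ordinal n2.
have i01 : (i0 < i1)%N by [].
have [e0 g] : exists e : var -> H, good i0 i1 (@params n H e).
  apply: contrapT => ng.
  have : forall e : var -> N2 f, good i0 i1 (@params n _ e) -> False.
    apply/(definable_transfer HG
      (definable_imp (definable_good i0 i1) definable_false)) => e ge.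
    by apply: ng; exists e.
  pose e : var -> N2 f := fun v => if v is inr (_, k) then
    if insub k is Some i then std f i else 1%g else 1%g.
  move/(_ e); rewrite (_ : params e = std f); first by apply; apply: good_std.
  by apply/funext => i; rewrite /params /e valK.
(* One implication for all formulas suffices: for a sentence it can also be
   applied to the negation. *)
have RS phi : models (ring_structure R) phi -> models (ring_structure (scal g)) phi.
  move=> Rphi e.
  have : forall e : var -> H, good i0 i1 (@params n H e) -> interp i0 i1 phi e.
    apply/(definable_transfer HG
      (definable_imp (definable_good i0 i1) (definable_interp i0 i1 phi))) => e' ge'.
    by exists ge'; apply: (models_scalar i01 ge' phi).1.
  (* Slot 0 keeps the good tuple, and the ring variables take the given
     values. *)
  pose e1 : var -> H := fun v => if v is inr (c, k) then
    if c == 0%N then e0 v else val (e k) else 1%g.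
  move=> /(_ e1 g)[g']; rewrite (Prop_irrelevance g' g).
  have -> // : @scal_env n i0 i1 H e1 g = e.
  by apply/funext => v; apply: retractK.
exists (scal g), (cocycle g); split; last exact: group_isomorphic_N2.
move=> phi sphi; split; first exact: RS.
move=> Sphi; apply: contrapT => nR.
have /RS/(_ (fun=> 0%R)) : models (ring_structure R) (Imp phi Bot).
  move=> e /= Re; apply: nR => e'; move: Re; apply holds_ext => v /sphi.
  by [].
by apply; apply: Sphi.
Qed.
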